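(* Let $q$ be a prime power, $m,t$ positive integers, $\alpha$ an element with $\mathbb{F}_{q^m}=\mathbb{F}_q[\alpha]$, and let $r\ge1$, $h\ge r$ be integers. Let \[A_{h,r}=\left[\begin{array}{c|c|c|c|c} I_r & 0 & 0 & \cdots & 0\\ \hline 0 & I_{h-r} & \alpha I_{h-r} & \cdots & \alpha^{m-1}I_{h-r}\end{array}\right]\in\mathbb{F}_{q^m}^{h\times(r+m(h-r))},\] and let $G_t$ be the $th\times t(r+m(h-r))$ block diagonal matrix with $t$ diagonal blocks equal to $A_{h,r}$. Then the system with generator matrix $G_t$, namely $(\mathcal{U}_1,\dots,\mathcal{U}_t)$ where $\mathcal{U}_i\subseteq\mathbb{F}_{q^m}^{th}$ is the $\mathbb{F}_q$-span of the columns of the $i$-th block column of $G_t$, is a homogeneous sum-rank $rt$-saturating $[(m(h-r)+r,\dots,m(h-r)+r),th]_{q^m/q}$ system. Consequently \[s^{\mathrm{hom}}_{q^m/q}(th,tr,t)\le t(m(h-r)+r).\]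
   Context: An $[\mathbf{n},k]_{q^m/q}$ system ($\mathbf{n}=(n_1,\dots,n_t)$) is a tuple $(\mathcal{U}_1,\dots,\mathcal{U}_t)$ of $\mathbb{F}_q$-subspaces of $\mathbb{F}_{q^m}^k$ with $\dim_{\mathbb{F}_q}\mathcal{U}_i=n_i$ whose union spans $\mathbb{F}_{q^m}^k$ over $\mathbb{F}_{q^m}$; it is homogeneous if all $n_i$ are equal. For an $\mathbb{F}_q$-subspace $W$, $L_W=\{\langle u\rangle_{\mathbb{F}_{q^m}}:u\in W\setminus\{0\}\}\subseteq\mathrm{PG}(k-1,q^m)$. A point set $\mathcal{S}$ is $s$-saturating if every point of $\mathrm{PG}(k-1,q^m)$ lies in the $\mathbb{F}_{q^m}$-span of some $s+1$ points of $\mathcal{S}$ and $s$ is minimal with this property; a system is sum-rank $\rho$-saturating if $L_{\mathcal{U}_1}\cup\cdots\cup L_{\mathcal{U}_t}$ is $(\rho-1)$-saturating. The homogeneous shortest length $s^{\mathrm{hom}}_{q^m/q}(k,\rho,t)$ is the minimum of $tn$ over all $t$-tuples $(\mathcal{U}_1,\dots,\mathcal{U}_t)$ of $\mathbb{F}_q$-subspaces of $\mathbb{F}_{q^m}^k$, each of $\mathbb{F}_q$-dimension $n$, forming a sum-rank $\rho$-saturating system.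
   Formalization: The hypothesis r ≤ m is added: for r > m every such system is saturating with parameter at most tm < tr, so the system of G_t is not rt-saturating and the homogeneous shortest length is undefined (e.g. m = t = 1, h = r = 2). *)

(* Defs.v *)
From HB Require Import structures.
From mathcomp Require Import all_boot all_order all_fingroup all_algebra all_field.

Set Implicit Arguments.
Unset Strict Implicit.
Unset Printing Implicit Defensive.

Import GRing.Theory.
Local Open Scope ring_scope.

(* F_q is F : finFieldType and F_{q^m} is L : fieldExtType F of dimension m.
   A vector of F_{q^m}^k is a {ffun 'I_k -> L} when F_q-subspaces are meant
   (its canonical vector space structure is over F) and a 'cV[L]_k when
   F_{q^m}-subspaces are meant (there it is over L); colv goes from the first
   to the second.  A point of PG(k-1,q^m) is an element of {vspace 'cV[L]_k} of
   dimension 1. *)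

Section Systems.

Variables (F : finFieldType) (L : fieldExtType F) (k : nat).

Definition colv (u : {ffun 'I_k -> L}) : 'cV[L]_k := \col_a u a.

Definition is_point (P : {vspace 'cV[L]_k}) : Prop := \dim P = 1%N.

Definition is_system (t : nat) (n : 'I_t -> nat)
    (U : 'I_t -> {vspace {ffun 'I_k -> L}}) : Prop :=
  (forall i, \dim (U i) = n i) /\
  (forall v : 'cV[L]_k, exists2 X : seq {ffun 'I_k -> L},
     (forall u, u \in X -> exists i, u \in U i) &
     v \in <<[seq colv u | u <- X]>>%VS).

Definition homogeneous (t : nat) (U : 'I_t -> {vspace {ffun 'I_k -> L}}) :
    Prop :=
  forall i j, \dim (U i) = \dim (U j).

Definition linear_set (W : {vspace {ffun 'I_k -> L}})
    (P : {vspace 'cV[L]_k}) : Prop :=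
  exists u, [/\ u \in W, u != 0 & P = <[colv u]>%VS].

Definition covers (s : nat) (S : {vspace 'cV[L]_k} -> Prop) : Prop :=
  forall Q, is_point Q -> exists Ps : seq {vspace 'cV[L]_k},
    [/\ size Ps = s.+1, uniq Ps, forall P, P \in Ps -> S P &
        (Q <= \sum_(P <- Ps) P)%VS].

Definition saturating (s : nat) (S : {vspace 'cV[L]_k} -> Prop) : Prop :=
  covers s S /\ forall s', covers s' S -> (s <= s')%N.

(* rho >= 1 is required so that rho - 1 is not a truncated subtraction. *)
Definition sumrank_saturating (t : nat) (rho : nat)
    (U : 'I_t -> {vspace {ffun 'I_k -> L}}) : Prop :=
  (0 < rho)%N /\ saturating (rho - 1) (fun P => exists i, linear_set (U i) P).

Definition system_of_mx (t : nat) (n : 'I_t -> nat)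
    (G : 'M[L]_(k, \sum_i n i)) (i : 'I_t) : {vspace {ffun 'I_k -> L}} :=
  <<[seq [ffun a => submxrow G i a j] | j : 'I_(n i)]>>%VS.

End Systems.

Definition hom_lengths (F : finFieldType) (L : fieldExtType F)
    (k rho t N : nat) : Prop :=
  exists n (U : 'I_t -> {vspace {ffun 'I_k -> L}}),
    [/\ N = (t * n)%N, is_system (fun=> n) U & sumrank_saturating rho U].

(* s is the value of s^hom_{q^m/q}(k, rho, t); a relation, since the minimum
   is undefined when no homogeneous saturating system exists. *)
Definition is_hom_shortest_length (F : finFieldType) (L : fieldExtType F)
    (k rho t s : nat) : Prop :=
  hom_lengths L k rho t s /\ forall N, hom_lengths L k rho t N -> (s <= N)%N.

Lemma sum_const_ord (t n : nat) : (\sum_(i < t) n = t * n)%N.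
Proof. by rewrite sum_nat_const card_ord. Qed.

Section GeneratorMatrix.

Variables (R : fieldType) (alpha : R) (m r h : nat) (le_rh : (r <= h)%N).

Definition Amx : 'M[R]_(h, r + m * (h - r)) :=
  castmx (subnKC le_rh, congr1 (addn r) (sum_const_ord m (h - r)))
    (block_mx 1%:M 0
              0    (\mxrow_(l < m) (alpha ^+ l)%:M : 'M_(h - r, _))).

Definition Gmx (t : nat) : 'M[R]_(t * h, \sum_(i < t) (r + m * (h - r))) :=
  castmx (sum_const_ord t h, erefl)
    (\mxblock_(i < t, j < t) if i == j then Amx else 0).

End GeneratorMatrix.

(* Main.v *)
Require Import Defs.
From HB Require Import structures.
From mathcomp Require Import all_boot all_order all_fingroup all_algebra all_field.
From Stdlib Require Import Classical.

Set Implicit Arguments.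
Unset Strict Implicit.
Unset Printing Implicit Defensive.

Import GRing.Theory.
Local Open Scope ring_scope.

(** The [i]-th space of the system consists of the vectors supported in block
    [i] whose first [r] block coordinates lie in [F], the remaining [h - r]
    being arbitrary in [L].  A vector [(x, y)] of [L ^ r * L ^ (h - r)] is the
    combination [\sum_j x_j (e_j, z_j)], where all [z_j] vanish except at one
    [j] with [x_j != 0], where [z_j = y / x_j]; if [x = 0], the vector [(0, y)]
    itself is available.  So [r] points per block suffice.  Conversely, the
    vector equal to [(1, alpha, ..., alpha ^ (r - 1), 0)] in every block needs
    [r] points from each block, since [1, alpha, ..., alpha ^ (r - 1)] are
    independent over [F]. *)

(** Needed for [hom_lengths], which is not a decidable predicate: excluded middle and strong
    induction supply its minimum. *)
Lemma exists_least_nat (P : nat -> Prop) (n : nat) :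
  P n -> exists2 s, P s /\ (forall N, P N -> (s <= N)%N) & (s <= n)%N.
Proof.
elim/ltn_ind: n => n IHn Pn.
case: (classic (exists2 N, P N & (N < n)%N)) => [[N PN ltNn]|noN].
  have [s Ps les] := IHn N ltNn PN.
  by exists s => //; apply: leq_trans les (ltnW ltNn).
exists n => //; split=> // N PN; rewrite leqNgt; apply/negP=> ltNn.
by apply: noN; exists N.
Qed.

(** * Spans and independence of finite indexed families *)

Section SpanFamily.

Variables (K : fieldType) (vT : vectType K) (n : nat) (g : 'I_n -> vT).

Lemma memv_span_familyP (u : vT) :
  u \in <<[seq g j | j : 'I_n]>>%VS <->
  exists c : 'I_n -> K, u = \sum_j c j *: g j.
Proof.
have -> : [seq g j | j : 'I_n] = [tuple g j | j < n] by [].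
split=> [/coord_span ->|[c ->]].
  exists (fun j => coord [tuple g j | j < n] j u).
  by apply: eq_bigr => j _; rewrite (nth_map j) ?nth_ord_enum // size_enum_ord.
by apply: memv_suml => j _; apply/memvZ/memv_span/map_f; rewrite mem_enum.
Qed.

Lemma free_familyP :
  free [seq g j | j : 'I_n] <->
  (forall c : 'I_n -> K, \sum_j c j *: g j = 0 -> forall j, c j = 0).
Proof.
have -> : [seq g j | j : 'I_n] = [tuple g j | j < n] by [].
have nthE (j : 'I_n) : [tuple g j | j < n]`_j = g j.
  by rewrite (nth_map j) ?nth_ord_enum // size_enum_ord.
split=> [/freeP fr c c0|H]; last apply/freeP => c c0.
  by apply: fr; rewrite -[RHS]c0; apply: eq_bigr => j _; rewrite nthE.
by apply: H; rewrite -[RHS]c0; apply: eq_bigr => j _; rewrite nthE.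
Qed.

Lemma dim_span_family :
  (forall c : 'I_n -> K, \sum_j c j *: g j = 0 -> forall j, c j = 0) ->
  \dim <<[seq g j | j : 'I_n]>>%VS = n.
Proof.
move=> /free_familyP; rewrite /free => /eqP ->.
by rewrite size_map size_enum_ord.
Qed.

End SpanFamily.

(** * The power basis of [L] over [F] *)

Section PowerBasis.

Variables (F : fieldType) (L : fieldExtType F) (m : nat) (alpha : L).
Hypotheses (dim_L : \dim {:L} = m) (gen_alpha : <<1; alpha>>%VS = {:L}%VS).

(** Adjoining [alpha] gives all of [L], so its degree is [m] and [y] is the value at [alpha] of a
    polynomial over [F] of size at most [m]. *)
Lemma powers_span (y : L) : exists c : 'I_m -> F, y = \sum_l c l *: alpha ^+ l.
Proof.
have deg : adjoin_degree 1 alpha = m.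
  by have := dim_Fadjoin 1 alpha; rewrite gen_alpha dim_L dimv1 muln1.
have yin : y \in <<1; alpha>>%VS by rewrite gen_alpha memvf.
have := size_Fadjoin_poly 1 alpha y; have := Fadjoin_polyOver 1 alpha y.
rewrite deg -{3}(Fadjoin_poly_eq yin).
set p := Fadjoin_poly _ _ _ => /polyOverP p1 sp.
have /fin_all_exists [c cE] : forall l : 'I_m, exists c, p`_l = c%:A.
  by move=> l; apply/vlineP/p1.
exists c; rewrite (horner_coef_wide _ sp).
by apply: eq_bigr => l _; rewrite cE mulr_algl.
Qed.

(** The [m] powers span a space of dimension [m], hence are free. *)
Lemma powers_free (c : 'I_m -> F) :
  \sum_l c l *: alpha ^+ l = 0 -> forall l, c l = 0.
Proof.
move: c; apply/free_familyP; rewrite /free size_map size_enum_ord -[X in _ == X]dim_L.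
have -> // : <<[seq (alpha ^+ l)%R | l : 'I_m]>>%VS = fullv.
apply/eqP; rewrite eqEsubv subvf /=; apply/subvP=> y _.
by apply/memv_span_familyP/powers_span.
Qed.

Lemma powers_free_le (r : nat) (c : 'I_r -> F) : (r <= m)%N ->
  \sum_l c l *: alpha ^+ l = 0 -> forall l, c l = 0.
Proof.
move=> le_rm c0 l.
(* The relation is padded with zero coefficients up to [m] terms; [e] is defined on all of [nat] so
   that the summation range can be widened. *)
pose e (k : nat) : L := (if insub k is Some k' then c k' else 0) *: alpha ^+ k.
pose d (k : 'I_m) := if insub (k : nat) is Some k' then c k' else 0.
have dE k : d (widen_ord le_rm k) = c k by rewrite /d /= valK.
have eE : \sum_(k < m) e k = 0.
  rewrite -[RHS]c0 [RHS](eq_bigr (fun k : 'I_r => e k)); last first.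
    by move=> k _; rewrite /e valK.
  rewrite [RHS](big_ord_widen m e) // [RHS]big_mkcond; apply: eq_bigr => k _ /=.
  by rewrite /e; case: insubP => [? -> //|/negbTE ->]; rewrite scale0r.
by rewrite -dE; apply: powers_free eE _.
Qed.

End PowerBasis.

(** * Splitting an index into block and position *)

Section BlockIndex.

Variables (n s : nat).

(** [tagnat.Rank] is the indexing behind [\mxblock] and [\mxrow]; this numbering serves both the
    rows of [Gmx] and the last columns of [Amx]. *)
Definition blk_ord (i : 'I_n) (a : 'I_s) : 'I_(n * s) :=
  cast_ord (sum_const_ord n s) (tagnat.Rank i a).

Definition ord_blk (k : 'I_(n * s)) : 'I_n * 'I_s :=
  let k' := cast_ord (esym (sum_const_ord n s)) k in
  (tagnat.sig1 k', tagnat.sig2 k').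

Lemma blk_ordK i a : ord_blk (blk_ord i a) = (i, a).
Proof.
rewrite /ord_blk /blk_ord cast_ordK tagnat.Rank1K tagnat.Rank2K.
by congr (_, _); apply: val_inj.
Qed.

Lemma ord_blkK k : blk_ord (ord_blk k).1 (ord_blk k).2 = k.
Proof. by rewrite /blk_ord /ord_blk /= tagnat.sig2K cast_ordKV. Qed.

Lemma sum_blk_ord (V : nmodType) (f : 'I_(n * s) -> V) :
  \sum_k f k = \sum_i \sum_a f (blk_ord i a).
Proof.
rewrite pair_big (reindex (fun p => blk_ord p.1 p.2)) //=.
exists ord_blk => [[i a] _|k _]; [exact: blk_ordK | exact: ord_blkK].
Qed.

End BlockIndex.

(** * Entries of the generator matrix *)

Section GeneratorEntries.

Variables (R : fieldType) (alpha : R) (m r h t : nat) (le_rh : (r <= h)%N).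

Local Notation A := (Amx alpha m le_rh).

Definition lo_ord (a : 'I_r) : 'I_h := cast_ord (subnKC le_rh) (lshift _ a).
Definition hi_ord (b : 'I_(h - r)) : 'I_h := cast_ord (subnKC le_rh) (rshift _ b).

Lemma lo_hi_ordP (a : 'I_h) :
  (exists2 c, a = lo_ord c & (a < r)%N) \/ (exists2 b, a = hi_ord b & (r <= a)%N).
Proof.
have := splitP (cast_ord (esym (subnKC le_rh)) a) => -[c /= ac|b /= ab].
  by left; exists c => //; apply: val_inj.
by right; exists b; [apply: val_inj | rewrite ab leq_addr].
Qed.

Lemma Amx_lo_l a c : A (lo_ord a) (lshift _ c) = (a == c)%:R.
Proof.
rewrite castmxE cast_ordK.
have -> : cast_ord (esym (congr1 (addn r) (sum_const_ord m (h - r)))) (lshift _ c)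
          = lshift _ c by apply: val_inj.
by rewrite block_mxEul mxE.
Qed.

Lemma Amx_rshift_cast l b :
  cast_ord (esym (congr1 (addn r) (sum_const_ord m (h - r))))
    (rshift r (blk_ord l b)) = rshift r (tagnat.Rank l b).
Proof. exact: val_inj. Qed.

Lemma Amx_lo_r a l b : A (lo_ord a) (rshift _ (blk_ord l b)) = 0.
Proof. by rewrite castmxE cast_ordK Amx_rshift_cast block_mxEur mxE. Qed.

Lemma Amx_hi_l b c : A (hi_ord b) (lshift _ c) = 0.
Proof.
rewrite castmxE cast_ordK.
have -> : cast_ord (esym (congr1 (addn r) (sum_const_ord m (h - r)))) (lshift _ c)
          = lshift _ c by apply: val_inj.
by rewrite block_mxEdl mxE.
Qed.

Lemma Amx_hi_r b l b' :
  A (hi_ord b) (rshift _ (blk_ord l b')) = alpha ^+ l *+ (b == b').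
Proof.
rewrite castmxE cast_ordK Amx_rshift_cast block_mxEdr !mxE.
have := blk_ordK l b'; rewrite /ord_blk /blk_ord cast_ordK => -[-> E].
by congr (_ *+ (_ == _)); exact: E.
Qed.

Lemma submxrow_Gmx i i' (a : 'I_h) j :
  submxrow (Gmx alpha m le_rh t) i (blk_ord i' a) j =
  if i' == i then A a j else 0.
Proof.
rewrite !mxE castmxE cast_ordK cast_ord_id mxE.
have := blk_ordK i' a; rewrite /ord_blk /blk_ord cast_ordK => -[-> _].
rewrite tagnat.Rank1K; case: eqP => // _; last by rewrite mxE.
by rewrite !tagnat.Rank2K; congr (A _ _); apply: val_inj.
Qed.

End GeneratorEntries.

Lemma is_point_vline (F : finFieldType) (L : fieldExtType F) (k : nat)
    (Q : {vspace 'cV[L]_k}) : is_point Q -> exists v, Q = <[v]>%VS.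
Proof.
move=> dQ; exists (vpick Q); apply/esym/eqP.
rewrite eqEdim -memvE memv_pick dQ dim_vline vpick0 -dimv_eq0.
by rewrite [\dim Q]dQ.
Qed.

(** * The system: membership, dimension, covering, minimality, spanning *)

Section SaturatingSystem.

Variables (F : finFieldType) (L : fieldExtType F) (m t r h : nat) (alpha : L).
Hypotheses (dim_L : \dim {:L} = m) (gen_alpha : <<1; alpha>>%VS = {:L}%VS).
Hypothesis le_rh : (r <= h)%N.

Local Notation U := (system_of_mx (Gmx alpha m le_rh t)).
Local Notation ncols := (r + m * (h - r))%N.

Let gencol (i : 'I_t) (j : 'I_ncols) : {ffun 'I_(t * h) -> L} :=
  [ffun a => submxrow (Gmx alpha m le_rh t) i a j].

Lemma gencol_comb i (c : 'I_ncols -> F) i' a :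
  (\sum_j c j *: gencol i j) (blk_ord i' a) =
  if i' == i then \sum_j c j *: Amx alpha m le_rh a j else 0.
Proof.
rewrite sum_ffunE.
transitivity (\sum_j c j *: submxrow (Gmx alpha m le_rh t) i (blk_ord i' a) j).
  by apply: eq_bigr => j _; rewrite !ffunE.
case: eqP => [->|/eqP ne].
  by apply: eq_bigr => j _; rewrite submxrow_Gmx eqxx.
by rewrite big1 // => j _; rewrite submxrow_Gmx (negbTE ne) scaler0.
Qed.

Lemma Amx_comb_lo (c : 'I_ncols -> F) a :
  \sum_j c j *: Amx alpha m le_rh (lo_ord le_rh a) j = (c (lshift _ a))%:A.
Proof.
rewrite big_split_ord /= [X in _ + X]big1 ?addr0; last first.
  by move=> k _; rewrite -(ord_blkK k) Amx_lo_r scaler0.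
rewrite (bigD1 a) //= big1 ?addr0 => [|j /negbTE ne].
  by rewrite Amx_lo_l eqxx.
by rewrite Amx_lo_l eq_sym ne scaler0.
Qed.

Lemma Amx_comb_hi (c : 'I_ncols -> F) b :
  \sum_j c j *: Amx alpha m le_rh (hi_ord le_rh b) j =
  \sum_l c (rshift r (blk_ord l b)) *: alpha ^+ l.
Proof.
rewrite big_split_ord /= [X in X + _]big1 ?add0r; last first.
  by move=> k _; rewrite Amx_hi_l scaler0.
rewrite sum_blk_ord; apply: eq_bigr => l _.
rewrite (bigD1 b) //= big1 ?addr0 => [|j /negbTE ne].
  by rewrite Amx_hi_r eqxx.
by rewrite Amx_hi_r eq_sym ne scaler0.
Qed.

(** The identity block makes the first [r] coordinates of block [i] equal to coefficients, hence in
    [F]; the others are expansions in powers of [alpha] with free coefficients, hence arbitrary. *)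
Lemma mem_systemP i (u : {ffun 'I_(t * h) -> L}) :
  u \in U i <->
  (forall i' a, i' != i -> u (blk_ord i' a) = 0) /\
  (forall a : 'I_h, (a < r)%N -> u (blk_ord i a) \in 1%VS).
Proof.
rewrite (memv_span_familyP (gencol i)); split=> [[c ->]|[u0 u1]].
  split=> [i' a ne|a]; rewrite gencol_comb ?(negbTE ne) // eqxx.
  case: (lo_hi_ordP le_rh a) => [[a' -> _] _|[b _]].
    by rewrite Amx_comb_lo rpredZ ?mem1v.
  by rewrite leqNgt => /negbTE ->.
have /fin_all_exists [c1 c1E] :
    forall a, exists c, u (blk_ord i (lo_ord le_rh a)) = c%:A.
  by move=> a; apply/vlineP/u1 => /=.
have /fin_all_exists [c2 c2E] : forall b, exists c : 'I_m -> F,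
    u (blk_ord i (hi_ord le_rh b)) = \sum_l c l *: alpha ^+ l.
  by move=> b; apply: powers_span.
(* Right column [(l, b)] receives the [l]-th coefficient of the entry at [b], whence the swapped
   components. *)
exists (fun j => match split j with
  | inl a => c1 a | inr k => c2 (ord_blk k).2 (ord_blk k).1 end).
apply/ffunP => k; rewrite -(ord_blkK k); move: (ord_blk k).1 (ord_blk k).2.
move=> i' a; rewrite gencol_comb; case: eqP => [->|/eqP ne]; last exact: u0.
case: (lo_hi_ordP le_rh a) => [[a' -> _]|[b -> _]].
  by rewrite Amx_comb_lo (unsplitK (inl a')) c1E.
rewrite Amx_comb_hi c2E; apply: eq_bigr => l _.
by rewrite (unsplitK (inr _)) blk_ordK.
Qed.

(** The columns are free: in a relation, the first [r] rows kill the left coefficients, and each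
    other row is a relation among powers of [alpha]. *)
Lemma dim_system i : \dim (U i) = (m * (h - r) + r)%N.
Proof.
rewrite [RHS]addnC; apply: (dim_span_family (g := gencol i)) => c c0.
have c00 a : \sum_j c j *: Amx alpha m le_rh a j = 0.
  have := congr1 (fun u : {ffun _ -> _} => u (blk_ord i a)) c0.
  by rewrite gencol_comb eqxx ffunE.
move=> j; rewrite -(splitK j); case: (split j) => [a|k] /=.
  have /eqP := c00 (lo_ord le_rh a); rewrite Amx_comb_lo scaler_eq0 oner_eq0 orbF.
  by move/eqP.
rewrite -(ord_blkK k); move: (ord_blk k).1 (ord_blk k).2 => l b.
have := c00 (hi_ord le_rh b); rewrite Amx_comb_hi => c1.
exact: (powers_free dim_L gen_alpha c1 l).
Qed.

(* Each of the [r] vectors has a coordinate at which it alone is nonzero, so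
   they span distinct points. *)
Lemma block_cover (w : 'I_h -> L) : (0 < r)%N ->
  exists (u : 'I_r -> 'I_h -> L) (lam : 'I_r -> L),
  [/\ forall j (a : 'I_h), (a < r)%N -> u j a \in 1%VS,
      forall a, \sum_j lam j * u j a = w a &
      forall j, exists2 a, u j a != 0 & forall j', j' != j -> u j' a = 0].
Proof.
move=> r_gt0; pose iota := widen_ord le_rh.
have iotaE (a : 'I_h) (lt_ar : (a < r)%N) : a = iota (Ordinal lt_ar).
  exact: val_inj.
have lt_iota (j : 'I_r) : (iota j < r)%N := ltn_ord j.
have delta1 (b : bool) : (b%:R : L) \in 1%VS.
  by case: b; rewrite ?mem0v ?mem1v.
case: (pickP (fun p => w (iota p) != 0)) => [p wp|w0].
  (* Unit vectors, the one at [p] also carrying the tail of [w] divided by [w (iota p)]. *)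
  exists (fun j (a : 'I_h) => if (a < r)%N then (a == iota j)%:R
                     else if j == p then w a / w (iota p) else 0).
  exists (fun j => w (iota j)); split.
  - by move=> j a ->.
  - move=> a; case: (boolP (a < r)%N) => [lt_ar|_].
      rewrite (bigD1 (Ordinal lt_ar)) //= -iotaE eqxx mulr1 big1 ?addr0 //.
      move=> j ne; rewrite (_ : (a == iota j) = false) ?mulr0 //.
      by apply: contraNF ne => /eqP aj; apply/eqP/val_inj; rewrite /= aj.
    rewrite (bigD1 p) //= eqxx mulrC mulfVK // big1 ?addr0 // => j /negbTE ->.
    by rewrite mulr0.
  - move=> j; exists (iota j); first by rewrite lt_iota eqxx oner_eq0.
    move=> j' ne; rewrite lt_iota (_ : (iota j == iota j') = false) //.
    by apply: contraNF ne => /eqP /(congr1 val) /= E; apply/eqP/val_inj.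
have {}w0 j : w (iota j) = 0 by apply/eqP/negbFE/w0.
have sep j j' : j' != j -> ((iota j == iota j')%:R : L) = 0.
  move=> ne; rewrite (_ : (iota j == iota j') = false) //.
  by apply: contraNF ne => /eqP /(congr1 val) /= E; apply/eqP/val_inj.
case: (pickP (fun b => w b != 0)) => [b wb|ww0]; last first.
  (* If [w = 0], unit vectors with zero coefficients do: [r] distinct points are still required. *)
  exists (fun j (a : 'I_h) => (a == iota j)%:R), (fun=> 0); split=> //.
  - by move=> a; rewrite big1 => [|j _]; rewrite ?mul0r // (eqP (negbFE (ww0 a))).
  - move=> j; exists (iota j); rewrite ?eqxx ?oner_eq0 //; exact: sep.
have ge_br : (r <= b)%N.
  by rewrite leqNgt; apply: contra wb => lt_br; rewrite (iotaE b lt_br) w0.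
pose p := Ordinal r_gt0.
(* Only the tail of [w] is nonzero: [w] itself replaces one unit vector and is separated at [b]; the
   other vectors are fillers with coefficient 0. *)
exists (fun j (a : 'I_h) => if j == p then w a else (a == iota j)%:R), (fun j => (j == p)%:R).
split.
- move=> j a lt_ar; case: ifP => // _.
  by rewrite (iotaE a lt_ar) w0 mem0v.
- move=> a; rewrite (bigD1 p) // eqxx mul1r big1 /= ?addr0 // => j /negbTE ->.
  by rewrite mul0r.
- move=> j; have [->|ne] := eqVneq j p.
    exists b => // j' /negbTE ->.
    rewrite (_ : (b == iota j') = false) //; apply/negbTE/negP => /eqP bj.
    by move: ge_br; rewrite bj leqNgt lt_iota.
  exists (iota j); rewrite ?eqxx ?oner_eq0 //.
  by move=> j' ne'; case: ifP => // _; apply: sep.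
Qed.

(** [block_cover] is applied to each block of a generator of the point, and the vectors found are
    extended by zero. *)
Lemma system_covers : (0 < r)%N -> (0 < t)%N ->
  covers (r * t - 1) (fun P => exists i, linear_set (U i) P).
Proof.
move=> r_gt0 t_gt0 Q /is_point_vline[v ->].
have /fin_all_exists [u] := fun i => block_cover (fun a => v (blk_ord i a) 0) r_gt0.
case/fin_all_exists => lam uP.
pose g (p : 'I_t * 'I_r) : {ffun 'I_(t * h) -> L} :=
  [ffun k => if (ord_blk k).1 == p.1 then u p.1 p.2 (ord_blk k).2 else 0].
have gE p i a : g p (blk_ord i a) = if i == p.1 then u p.1 p.2 a else 0.
  by rewrite ffunE blk_ordK.
have gsep p : exists2 k, g p k != 0 & forall p', p' != p -> g p' k = 0.
  case: p => i j; have [_ _ /(_ j)[a nz sep]] := uP i.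
  exists (blk_ord i a); first by rewrite gE eqxx.
  case=> i' j' ne; rewrite gE /=; case: eqP => // ii; subst i'.
  by apply: sep; apply: contra ne => /eqP ->.
(* At the separating coordinate of [g p], every multiple of another [g p'] vanishes, so the points
   are distinct. *)
have g_inj : injective (fun p => <[colv (g p)]>%VS).
  move=> p p' E; apply/eqP; apply: contraT => ne.
  have [k nz sep] := gsep p.
  have /vlineP[c /matrixP/(_ k 0)] : colv (g p) \in <[colv (g p')]>%VS.
    by rewrite -E memv_line.
  by rewrite !mxE (sep p') 1?eq_sym // mulr0 => /eqP; rewrite (negbTE nz).
exists [seq <[colv (g p)]>%VS | p : 'I_t * 'I_r]; split.
- rewrite size_map -cardE card_prod !card_ord mulnC.
  by case: (r * t)%N (muln_gt0 r t) => [|n]; rewrite ?r_gt0 ?t_gt0 //= subn1.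
- by rewrite map_inj_uniq ?enum_uniq.
- move=> P /mapP[p _ ->]; exists p.1, (g p); split=> //.
    apply/mem_systemP; split=> [i' a ne|a lt_ar]; rewrite gE ?(negbTE ne) //.
    by rewrite eqxx; have [H _ _] := uP p.1; apply: H.
  by have [k nz _] := gsep p; apply: contraNneq nz => ->; rewrite ffunE.
have -> : v = \sum_p lam p.1 p.2 *: colv (g p).
  apply/colP => k; rewrite -(ord_blkK k); move: (ord_blk k).1 (ord_blk k).2 => i a.
  have [_ <- _] := uP i.
  rewrite summxE -(pair_bigA _ (fun i' j => (lam i' j *: colv (g (i', j))) _ _)) /=.
  rewrite (bigD1 i) //= [X in _ + X]big1 ?addr0.
    by apply: eq_bigr => j _; rewrite !mxE gE eqxx.
  move=> i' ne; rewrite big1 // => j _.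
  by rewrite !mxE gE eq_sym (negbTE ne) mulr0.
rewrite big_map big_enum /= -memvE; apply: memv_sumr => p _.
exact/memvZ/memv_line.
Qed.

(* Fewer than [r * t] vectors of the system admit a common nonzero F-linear
   relation [f] among the F-valued coordinates. As each of them lives in a
   single block, [f] may be restricted to one block, where it would be an
   F-linear dependency between [1, alpha, ..., alpha ^ (r - 1)]. *)
Lemma system_covers_min s : (0 < r)%N -> (0 < t)%N -> (r <= m)%N ->
  covers s (fun P => exists i, linear_set (U i) P) -> (r * t - 1 <= s)%N.
Proof.
move=> r_gt0 t_gt0 le_rm cov; rewrite leqNgt; apply/negP => lt_s.
pose v : 'cV[L]_(t * h) :=
  \col_k if ((ord_blk k).2 < r)%N then alpha ^+ (ord_blk k).2 else 0.
pose iota := widen_ord le_rh.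
have vE i (a : 'I_r) : v (blk_ord i (iota a)) 0 = alpha ^+ a.
  by rewrite mxE blk_ordK /= ltn_ord.
have v_nz : v != 0.
  apply/eqP => /matrixP/(_ (blk_ord (Ordinal t_gt0) (iota (Ordinal r_gt0))) 0).
  by rewrite vE mxE expr0 => /eqP; rewrite oner_eq0.
have [|Ps [sz _ PsS]] := cov <[v]>%VS; first by rewrite /is_point dim_vline v_nz.
rewrite -memvE (big_nth 0%VS) big_mkord.
have /fin_all_exists [w] : forall k : 'I_(size Ps), exists w : {ffun 'I_(t * h) -> L},
    exists i, w \in U i /\ nth 0%VS Ps k = <[colv w]>%VS.
  by move=> k; have [i [w [wi _ E]]] := PsS _ (mem_nth 0%VS (ltn_ord k)); exists w, i.
case/fin_all_exists => idx wP.
case/memv_sumP => vk vkP vsum.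
have /fin_all_exists [lam lamE] : forall k, exists c, vk k = c *: colv (w k).
  by move=> k; apply/vlineP; have [_ <-] := wP k; apply: vkP.
(* The first [r] coordinates of each block are in [F], and vanish outside the block [idx k]
   containing [w k]. *)
have cP k i (a : 'I_r) : exists c : F,
    w k (blk_ord i (iota a)) = c%:A /\ (i != idx k -> c = 0).
  have [/mem_systemP[w0 w1] _] := wP k.
  have [->|ne] := eqVneq i (idx k); last by exists 0; rewrite w0 // scale0r.
  by have /vlineP[c cE] := w1 (iota a) (ltn_ord a); exists c.
have /fin_all_exists [c cE] := fun k => fin_all_exists (fun i => fin_all_exists (cP k i)).
(* There are [s.+1 < r * t] columns, so the left kernel is nonzero; a nonzero row of it is the
   relation [f]. *)
pose M := \matrix_(x < t * r, k < size Ps) c k (ord_blk x).1 (ord_blk x).2.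
have ker_nz : kermx M != 0.
  rewrite -mxrank_eq0 mxrank_ker subn_eq0 -ltnNge.
  apply: leq_ltn_trans (rank_leq_col M) _.
  by rewrite sz mulnC; move: lt_s; rewrite ltn_subRL add1n.
have fM : nz_row (kermx M) *m M = 0 by apply/sub_kermxP/nz_row_sub.
have := ker_nz; rewrite -nz_row_eq0; move: (nz_row _) fM => f fM /rV0Pn[x fx].
(* A block on which [f] does not vanish. *)
pose i0 := (ord_blk x).1.
have rel k : \sum_a f 0 (blk_ord i0 a) * c k i0 a = 0.
  have [ii|ne] := eqVneq i0 (idx k); last first.
    by rewrite big1 // => a _; have [_ ->] := cE k i0 a; rewrite ?mulr0.
  have /matrixP/(_ 0 k) := fM; rewrite !mxE sum_blk_ord (bigD1 i0) //=.
  rewrite [X in _ + X]big1 ?addr0.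
    move=> E; rewrite -[RHS]E; by apply: eq_bigr => a _; rewrite mxE blk_ordK.
  move=> i ne; rewrite big1 // => a _; rewrite mxE blk_ordK /=.
  by have [_ ->] := cE k i a; rewrite ?mulr0 // -ii.
suff dep : \sum_a f 0 (blk_ord i0 a) *: alpha ^+ a = 0.
  have := powers_free_le dim_L gen_alpha le_rm dep (ord_blk x).2.
  by rewrite ord_blkK => /eqP; rewrite (negbTE fx).
(* In block [i0] the entries [alpha ^+ a] of [v] are expanded along the [w k], and the sums are
   exchanged. *)
transitivity (\sum_k lam k * (\sum_a f 0 (blk_ord i0 a) * c k i0 a)%:A).
  transitivity (\sum_a \sum_k lam k * (f 0 (blk_ord i0 a) * c k i0 a)%:A).
    apply: eq_bigr => a _; rewrite -(vE i0) vsum summxE scaler_sumr.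
    apply: eq_bigr => k _; rewrite lamE !mxE; have [-> _] := cE k i0 a.
    by rewrite -scalerA scalerAr.
  by rewrite exchange_big; apply: eq_bigr => k _; rewrite scaler_suml mulr_sumr.
by rewrite big1 // => k _; rewrite rel scale0r mulr0.
Qed.

(** A nonzero [v] defines a point, which is covered; generators of the covering points, taken in the
    [U i], span [v]. *)
Lemma system_spans : (0 < r)%N -> (0 < t)%N -> is_system (fun=> (m * (h - r) + r)%N) U.
Proof.
move=> r_gt0 t_gt0; split=> [i|v]; first exact: dim_system.
have [->|v_nz] := eqVneq v 0; first by exists [::]; rewrite ?mem0v.
have [|Ps [_ _ PsS vPs]] := system_covers r_gt0 t_gt0 (Q := <[v]>%VS).
  by rewrite /is_point dim_vline v_nz.
suff [X XU XPs] : exists2 X : seq {ffun 'I_(t * h) -> L},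
    (forall u, u \in X -> exists i, u \in U i) &
    (\sum_(P <- Ps) P <= <<[seq colv u | u <- X]>>)%VS.
  by exists X => //; rewrite memvE (subv_trans vPs).
elim: Ps PsS {vPs} => [|P Ps IH] PsS; first by exists [::]; rewrite ?big_nil ?sub0v.
have [|X XU XPs] := IH; first by move=> P' P'in; apply: PsS; rewrite inE P'in orbT.
have [i [u [ui _ PE]]] := PsS P (mem_head _ _).
exists (u :: X); first by move=> u'; rewrite inE => /predU1P[->|/XU //]; exists i.
by rewrite big_cons /= span_cons PE addvS.
Qed.

End SaturatingSystem.

Theorem theorem3p12 (F : finFieldType) (L : fieldExtType F) (m t r h : nat)
    (alpha : L) (dim_L : \dim {:L} = m) (m_gt0 : (0 < m)%N) (t_gt0 : (0 < t)%N)
    (gen_alpha : <<1; alpha>>%VS = {:L}%VS)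
    (r_gt0 : (0 < r)%N) (le_rh : (r <= h)%N) (le_rm : (r <= m)%N) :
  (let U := system_of_mx (Gmx alpha m le_rh t) in
   [/\ is_system (fun _ : 'I_t => (m * (h - r) + r)%N) U,
       homogeneous U
     & sumrank_saturating (r * t) U])
  /\ (exists2 s : nat, is_hom_shortest_length L (t * h) (t * r) t s
        & (s <= t * (m * (h - r) + r))%N).
Proof.
set U := system_of_mx _.
have sys : is_system (fun=> (m * (h - r) + r)%N) U by apply: system_spans.
have sat : sumrank_saturating (r * t) U.
  split; first by rewrite muln_gt0 r_gt0.
  by split=> [|s]; [apply: system_covers | apply: system_covers_min].
split; first by split=> // i j; rewrite !sys.1.
apply: exists_least_nat; exists (m * (h - r) + r)%N, U; split=> //.
by rewrite [(t * r)%N]mulnC.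
Qed.
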